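(* If $f_i:V\to U_i$, $i=1,2$, are universal in $\mathcal{A}_R(V,B)$, then there exists a unique algebra isomorphism $F:U_1\to U_2$ such that $F\circ f_1=f_2$.
   Context: $R$ is a commutative ring with unit $1\neq0$; $V\neq\{0\}$ is a free unitary $R$-module; $B:V\times V\to R$ is a bilinear form which is diagonal in some basis $(e_i\mid i\in M)$ of $V$, i.e. $B(e_i,e_j)=0$ for $i\neq j$. An algebra is an $R$-module with an $R$-bilinear associative composition having a unit $1_A$; algebra morphisms map unit to unit. $\mathcal{A}_R(V,B)$ is the category of linear mappings $f$ from $V$ into an $R$-algebra $A$ such that $f(x)^2=B(x,x)1_A$ for all $x\in V$. A mapping $\rho:V\to U$ in $\mathcal{A}_R(V,B)$ is universal if for every linear mapping $f:V\to A$ in $\mathcal{A}_R(V,B)$ there is a unique algebra morphism $F:U\to A$ such that $F\circ\rho=f$. *)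

(* Defs.v *)
From HB Require Import structures.
From mathcomp Require Import all_boot all_order all_algebra.

Set Implicit Arguments.
Unset Strict Implicit.
Unset Printing Implicit Defensive.

Import GRing.Theory.
Local Open Scope ring_scope.

(* MathComp's [algType R] extends [nzRingType], i.e. it requires 1 != 0; the
   algebras considered here may be zero. *)
HB.mixin Record isUnitalAlgebra (R : comNzRingType) A of GRing.Lmodule R A := {
  alg_one : A;
  alg_mul : A -> A -> A;
  alg_mul_bilinear : bilinear_for *:%R *:%R alg_mul;
  alg_mulA : associative alg_mul;
  alg_mul1l : left_id alg_one alg_mul;
  alg_mul1r : right_id alg_one alg_mul
}.

#[short(type="unitalAlgType")]
HB.structure Definition UnitalAlgebra (R : comNzRingType) :=
  {A of GRing.Lmodule R A & isUnitalAlgebra R A}.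

HB.mixin Record isUnitalMultiplicative (R : comNzRingType)
    (A B : unitalAlgType R) (F : A -> B) := {
  alg_mor1 : F alg_one = alg_one;
  alg_morM : {morph F : x y / alg_mul x y}
}.

#[short(type="algMorphism")]
HB.structure Definition AlgMorphism (R : comNzRingType)
    (A B : unitalAlgType R) :=
  {F of @GRing.Linear R A B *:%R F & isUnitalMultiplicative R A B F}.

Section Definitions.

Variables (R : comNzRingType) (V : lmodType R).

(* The index type M is arbitrary, possibly infinite; a finite subfamily of e is
   given by an injection of some 'I_n into M. *)
Definition free_family (M : Type) (e : M -> V) : Prop :=
  forall (n : nat) (j : 'I_n -> M) (c : 'I_n -> R), injective j ->
    \sum_(k < n) c k *: e (j k) = 0 -> forall k, c k = 0.

Definition spanning_family (M : Type) (e : M -> V) : Prop :=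
  forall v : V, exists (n : nat) (j : 'I_n -> M) (c : 'I_n -> R),
    v = \sum_(k < n) c k *: e (j k).

Definition is_basis (M : Type) (e : M -> V) : Prop :=
  free_family e /\ spanning_family e.

Definition diagonal_in (B : {biscalar V}) (M : Type) (e : M -> V) : Prop :=
  forall i j : M, i <> j -> B (e i) (e j) = 0.

(* The objects of the category A_R(V, B). *)
Definition clifford_map (B : {biscalar V}) (A : unitalAlgType R)
    (f : {linear V -> A}) : Prop :=
  forall x : V, alg_mul (f x) (f x) = B x x *: alg_one.

Definition universal (B : {biscalar V}) (U : unitalAlgType R)
    (rho : {linear V -> U}) : Prop :=
  clifford_map B rho /\
  forall (A : unitalAlgType R) (f : {linear V -> A}), clifford_map B f ->
    exists F : algMorphism U A,
      F \o rho =1 f /\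
      forall G : algMorphism U A, G \o rho =1 f -> G =1 F.

End Definitions.

(* Main.v *)
Require Import Defs.
From HB Require Import structures.
From mathcomp Require Import all_boot all_order all_algebra.

(** A universal map is an initial object of the category of Clifford maps on
    [V], and initial objects are unique up to a unique isomorphism.  Each of
    [f1], [f2] factors through the other, by [F : U1 -> U2] and
    [G : U2 -> U1].  The endomorphism [G \o F] of [U1] fixes [f1], as does the
    identity, so the uniqueness half of universality makes them equal
    ([universal_retraction]); by symmetry [F \o G] is the identity of [U2].
    Uniqueness of [F] among isomorphisms is a case of its uniqueness among
    all morphisms. *)

Set Implicit Arguments.
Unset Strict Implicit.
Unset Printing Implicit Defensive.

Import GRing.Theory.
Local Open Scope ring_scope.

Section AlgMorphismCategory.

Variables (R : comNzRingType) (A B C : unitalAlgType R).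
Variables (F : algMorphism A B) (G : algMorphism B C).

Fact idfun_alg_mor1 : idfun (@alg_one R A) = alg_one.
Proof. by []. Qed.

Fact idfun_alg_morM : {morph (@idfun A) : x y / alg_mul x y}.
Proof. by []. Qed.

HB.instance Definition _ :=
  isUnitalMultiplicative.Build R A A idfun idfun_alg_mor1 idfun_alg_morM.

Fact comp_alg_mor1 : (G \o F) alg_one = alg_one.
Proof. by rewrite /= !alg_mor1. Qed.

Fact comp_alg_morM : {morph (G \o F) : x y / alg_mul x y}.
Proof. by move=> x y; rewrite /= !alg_morM. Qed.

HB.instance Definition _ :=
  isUnitalMultiplicative.Build R A C (G \o F) comp_alg_mor1 comp_alg_morM.

End AlgMorphismCategory.

(** Both [G \o F] and the identity factor [rho] through itself, and such a
    factorisation is unique. *)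
Lemma universal_retraction (R : comNzRingType) (V : lmodType R)
    (B : {biscalar V}) (U A : unitalAlgType R)
    (rho : {linear V -> U}) (f : {linear V -> A})
    (F : algMorphism U A) (G : algMorphism A U) :
  universal B rho -> F \o rho =1 f -> G \o f =1 rho -> cancel F G.
Proof.
move=> [rhoB rhoU] Frho Gf x.
have [H [_ Huniq]] := rhoU U rho rhoB.
have GF_H : G \o F =1 H.
  by apply: Huniq => v; rewrite -[RHS]Gf /= -Frho.
have id_H : idfun =1 H by apply: Huniq.
by rewrite -[RHS]/(idfun x) id_H -GF_H.
Qed.

Theorem theorem2 (R : comNzRingType) (V : lmodType R)
    (V_neq0 : exists v : V, v <> 0)
    (B : {biscalar V})
    (M : Type) (e : M -> V) (e_basis : is_basis e) (B_diag : diagonal_in B e)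
    (U1 U2 : unitalAlgType R)
    (f1 : {linear V -> U1}) (f2 : {linear V -> U2})
    (f1_univ : universal B f1) (f2_univ : universal B f2) :
  exists F : algMorphism U1 U2,
    (bijective F /\ F \o f1 =1 f2) /\
    forall G : algMorphism U1 U2,
      bijective G -> G \o f1 =1 f2 -> G =1 F.
Proof.
have [F [Ff1 Funiq]] := f1_univ.2 U2 f2 f2_univ.1.
have [G [Gf2 _]] := f2_univ.2 U1 f1 f1_univ.1.
exists F; split; last by move=> H _; apply: Funiq.
split=> //; exists G.
- exact: universal_retraction f1_univ Ff1 Gf2.
- exact: universal_retraction f2_univ Gf2 Ff1.
Qed.
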